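(* Let $G$ be a finite group and let $\to$ be a $G$-transfer system. The following are equivalent: (1) There is a $G$-universe $U$ such that $\to\ =\ \to_{\mathcal{K}(U)}$. (2) There are an integer $n\ge0$ and nontrivial, irreducible real $G$-representations $V_1,V_2,\dots,V_n$ such that $\to\ =\ \langle\bigcup_{i=1}^n Orb(V_i)\rangle$ (when $n=0$, this means that $\to$ is the minimum transfer system).
   Context: Let $G$ be a finite group and $\mathrm{Sub}(G)$ its set of subgroups. A $G$-transfer system is a partial order $\to$ on $\mathrm{Sub}(G)$ such that: if $K\to H$ then $K\subset H$; if $K\to H$ then $gKg^{-1}\to gHg^{-1}$ for all $g\in G$; if $K\to H$ and $L\subset H$ then $K\cap L\to L$. The minimum transfer system is equality. For a binary relation $R$ on $\mathrm{Sub}(G)$ refining inclusion (identified with its set of related pairs), $\langle R\rangle$ is the smallest $G$-transfer system containing $R$. For a real $G$-representation $V$, $Orb(V)=\{(K,G)\mid K\subsetneq G\text{ and there is an injective }G\text{-equivariant map of sets }G/K\hookrightarrow V\}$. A $G$-universe is a countably infinite dimensional real inner product space $U$ with a linear isometric $G$-action, which contains each of its (finite dimensional) subrepresentations infinitely often, and which contains trivial summands. Steiner operad: for a finite dimensional real orthogonal $G$-representation $V$, let $R_V$ be the $G$-space (under conjugation) of distance-reducing, not necessarily equivariant, embeddings $V\to V$. A $V$-Steiner path is a map $h:[0,1]\to R_V$ with $h(1)=\mathrm{id}$, and $\mathcal{K}(V)(n)$ is the $G\times\Sigma_n$-space of $n$-tuples $(h_1,\dots,h_n)$ of $V$-Steiner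 paths such that the images of $h_1(0),\dots,h_n(0)$ are disjoint. Set $\mathcal{K}(U)=\mathrm{colim}_{V\subset U}\mathcal{K}(V)$, over finite dimensional subrepresentations $V\subset U$ (for $V\subset W$ one takes the product with the identity on the orthogonal complement of $V$ in $W$). For $K\subset H\subset G$ with $n=|H:K|$, let $\Gamma(H/K)=\{(h,\sigma(h))\mid h\in H\}\subset G\times\Sigma_n$ be the graph of a permutation representation $\sigma:H\to\Sigma_n$ of $H/K$. The transfer system $\to_{\mathcal{K}(U)}$ is defined by: $K\to_{\mathcal{K}(U)}H$ iff $K\subset H$ and $\mathcal{K}(U)(n)^{\Gamma(H/K)}\neq\varnothing$. By a known theorem of Blumberg and Hill, for $K\subset H$ this holds iff there is an injective $H$-equivariant map of sets $H/K\hookrightarrow\mathrm{res}^G_HU$. *)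

(* Defs.v *)
(* MathComp, with MathComp-Analysis for the topology. *)
From HB Require Import structures.
From mathcomp Require Import all_boot all_order all_algebra.
From mathcomp Require Import all_fingroup all_character.
From mathcomp Require Import all_classical all_reals topology normedtype.
From mathcomp Require Import sesquilinear.

Set Implicit Arguments.
Unset Strict Implicit.
Unset Printing Implicit Defensive.

Import Order.TTheory GRing.Theory Num.Theory.
Import numFieldNormedType.Exports.

Local Open Scope ring_scope.

(* The finite group G is a whole [gT : finGroupType], so that Sub(G) is the
   type [{group gT}]. MathComp's [K :^ g] is [g^-1 K g]. *)

Section TransferSystems.
Variable gT : finGroupType.
Implicit Types (K L H : {group gT}) (E T : {group gT} -> {group gT} -> Prop).

Record transfer_system T : Prop := TransferSystem {
  transfer_refl : forall H, T H H;
  transfer_antisym : forall K H, T K H -> T H K -> K = H;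
  transfer_trans : forall L K H, T L K -> T K H -> T L H;
  transfer_sub : forall K H, T K H -> K \subset H;
  transfer_conj : forall K H g, T K H -> T (K :^ g^-1)%G (H :^ g^-1)%G;
  transfer_res : forall K H L, T K H -> L \subset H -> T (K :&: L)%G L
}.

Definition generated_transfer_system E : {group gT} -> {group gT} -> Prop :=
  fun K H => forall T, transfer_system T ->
    (forall K' H', E K' H' -> T K' H') -> T K H.

Lemma generated_transfer_system_least E :
    (forall K H, E K H -> K \subset H) ->
  [/\ transfer_system (generated_transfer_system E),
      forall K H, E K H -> generated_transfer_system E K H
    & forall T, transfer_system T -> (forall K H, E K H -> T K H) ->
        forall K H, generated_transfer_system E K H -> T K H].
Proof.
move=> subE.
have tsub : transfer_system (fun K H => K \subset H).
  split=> //.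
  - by move=> K H sKH sHK; apply/val_inj/eqP; rewrite finset.eqEsubset sKH.
  - by move=> L K H; apply: fintype.subset_trans.
  - by move=> K H g sKH; rewrite /= conjSg.
  - by move=> K H L _ _; rewrite /= subsetIr.
have genS K H : generated_transfer_system E K H -> K \subset H.
  by move/(_ _ tsub subE).
split=> [|K H EKH T _|T tT ET K H]; [split| exact |by apply].
- by move=> H T tT _; apply: transfer_refl.
- by move=> K H /genS sKH /genS sHK; apply: (transfer_antisym tsub).
- by move=> L K H LK KH T tT ET; apply: (transfer_trans tT (LK _ _ _) (KH _ _ _)).
- exact: genS.
- by move=> K H g KH T tT ET; apply: transfer_conj => //; apply: KH.
- by move=> K H L KH sLH T tT ET; apply: (transfer_res tT) sLH; apply: KH.
Qed.

(* There is an injective H-equivariant map of sets H/K -> X, where [a] is a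
   left action on X and H/K is the set of left cosets of K in H. *)
Definition coset_embeds (X : Type) (a : gT -> X -> X) K H : Prop :=
  exists f : {set gT} -> X,
    {in lcosets K H &, injective f} /\
    {in H & lcosets K H, forall h A, f (h *: A)%g = a h (f A)}.

(* [sigma], restricted to H, is a permutation representation of H/K. *)
Definition coset_perm_rep K H n (sigma : gT -> 'S_n) : Prop :=
  exists b : 'I_n -> {set gT},
    [/\ injective b, [set b i | i : 'I_n] = lcosets K H
      & {in H, forall h i, b (sigma h i) = (h *: b i)%g}].

Definition graph_subgroup H n (sigma : gT -> 'S_n) : {set gT * 'S_n} :=
  [set (h, sigma h) | h in H].

End TransferSystems.

Section Orb.
Variables (R : realType) (gT : finGroupType) (d : nat).
Variable rG : mx_representation R [set: gT] d.

(* MathComp matrix representations act on row vectors on the right; the left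
   G-representation V they encode has g v = v *m rG g^-1. *)
Definition repr_act (g : gT) (v : 'rV[R]_d) : 'rV[R]_d := v *m rG g^-1%g.

Definition Orb (K H : {group gT}) : Prop :=
  [/\ H = [set: gT]%G, K \proper [set: gT] & coset_embeds repr_act K H].

Definition nontrivial_repr : bool := ~~ ([set: gT] \subset rker rG).

End Orb.

(* Orthogonal representations, of arbitrary dimension. *)
Record orth_rep (R : realType) (gT : finGroupType) := OrthRep {
  orth_sort :> normedModType R;
  rep_dot : {dot orth_sort for (@idfun R)};
  rep_act : gT -> {linear orth_sort -> orth_sort};
  rep_dot_norm : forall v, rep_dot v v = `|v| ^+ 2;
  rep_act1 : forall v, rep_act 1%g v = v;
  rep_actM : forall g h v, rep_act (g * h)%g v = rep_act g (rep_act h v);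
  rep_act_isom : forall g v w, rep_dot (rep_act g v) (rep_act g w) = rep_dot v w
}.

Arguments rep_dot {R gT o}.
Arguments rep_act {R gT o}.

Section Representations.
Local Open Scope classical_set_scope.
Local Open Scope ring_scope.
Variables (R : realType) (gT : finGroupType).
Implicit Types U V W : orth_rep R gT.

Definition finite_dim V : Prop :=
  exists (d : nat) (b : 'I_d -> V),
    forall v, exists c : 'I_d -> R, v = \sum_i c i *: b i.

Definition countably_infinite_dim V : Prop :=
  exists b : nat -> V,
    (forall v, exists (d : nat) (c : 'I_d -> R), v = \sum_i c i *: b i) /\
    (forall (d : nat) (c : 'I_d -> R),
       \sum_i c i *: b i = 0 -> forall i, c i = 0).

(* A subrepresentation of V is given by the inclusion [i] of a representation
   W, i.e. an equivariant linear isometry. *)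
Definition subrep W V (i : {linear W -> V}) : Prop :=
  (forall w w', rep_dot (i w) (i w') = rep_dot w w') /\
  (forall g w, i (rep_act g w) = rep_act g (i w)).

Definition G_universe U : Prop :=
  [/\ countably_infinite_dim U,
      forall V (i : {linear V -> U}), finite_dim V -> subrep i ->
        exists f : nat -> {linear V -> U},
          (forall k, subrep (f k)) /\
          (forall k l, k != l -> forall v w, rep_dot (f k v) (f l w) = 0)
    & exists u : U, u != 0 /\ forall g, rep_act g u = u].

Definition topological_embedding (X Y : topologicalType) (f : X -> Y) : Prop :=
  [/\ injective f, continuous f
    & forall A : set X, open A -> exists2 B : set Y, open B & f @^-1` B = A].

(* The space R_V, topologized as a subspace of [{compact-open, V -> V}]. *)
Definition steiner_R V (f : V -> V) : Prop :=
  topological_embedding f /\ forall v w, `|f v - f w| <= `|v - w|.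

(* Only the restriction of [h] to [0,1] is meaningful. *)
Definition steiner_path V (h : R -> V -> V) : Prop :=
  [/\ {within `[0, 1], continuous (h : R -> {compact-open, V -> V})},
      forall t, t \in `[0, 1] -> steiner_R (h t)
    & forall v, h 1 v = v].

(* The elements of K(V)(n). *)
Definition steiner V n (x : 'I_n -> R -> V -> V) : Prop :=
  (forall m, steiner_path (x m)) /\
  (forall m m', m != m' -> forall v w, x m 0 v != x m' 0 w).

Definition steiner_act V n (p : gT * 'S_n) (x : 'I_n -> R -> V -> V) :
    'I_n -> R -> V -> V :=
  fun m t v => rep_act p.1 (x (p.2^-1%g m) t (rep_act p.1^-1%g v)).

(* [z] is the image of [x] under K(V)(n) -> K(W)(n) for the inclusion
   [i : V -> W]: the product of [x] with the identity on the orthogonal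
   complement of [i V]. *)
Definition steiner_extends V W (i : V -> W) n
    (x : 'I_n -> R -> V -> V) (z : 'I_n -> R -> W -> W) : Prop :=
  forall m t, t \in `[0, 1] ->
  forall v w, (forall v', rep_dot (i v') w = 0) ->
    z m t (i v + w) = i (x m t v) + w.

(* [(V, x)] and [(V', x')], with V and V' subrepresentations of U by [i] and
   [i'], represent the same point of the directed colimit K(U)(n). *)
Definition steiner_colim_eq U n V (i : V -> U) (x : 'I_n -> R -> V -> V)
    V' (i' : V' -> U) (x' : 'I_n -> R -> V' -> V') : Prop :=
  exists (W : orth_rep R gT) (k : {linear W -> U})
         (j : {linear V -> W}) (j' : {linear V' -> W}),
    [/\ finite_dim W, subrep k, k \o j =1 i & k \o j' =1 i'] /\
    exists z : 'I_n -> R -> W -> W,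
      [/\ steiner z, steiner_extends j x z & steiner_extends j' x' z].

(* K(U)(n)^Gamma is nonempty. *)
Definition steiner_fixed U n (Gamma : {set gT * 'S_n}) : Prop :=
  exists (V : orth_rep R gT) (i : {linear V -> U}) (x : 'I_n -> R -> V -> V),
    [/\ finite_dim V, subrep i, steiner x
      & forall p, p \in Gamma -> steiner_colim_eq i (steiner_act p x) i x].

Definition steiner_transfer U (K H : {group gT}) : Prop :=
  K \subset H /\
  exists sigma : gT -> 'S_(#|H : K|%g),
    coset_perm_rep K H sigma /\ steiner_fixed U (graph_subgroup H sigma).

End Representations.

(* Main.v *)
Require Import Defs.
From HB Require Import structures.
From mathcomp Require Import all_boot all_order all_algebra.
From mathcomp Require Import all_fingroup all_solvable all_character.
From mathcomp Require Import all_classical all_reals topology normedtype.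
From mathcomp Require Import sesquilinear.
From mathcomp Require Import ring lra zify.

Set Implicit Arguments.
Unset Strict Implicit.
Unset Printing Implicit Defensive.

Import Order.TTheory GRing.Theory Num.Theory.
Import numFieldNormedType.Exports.

Local Open Scope ring_scope.

(** Everything is expressed through isotropy groups of points. For a set [X] with
    an action of [G], there is an injective [H]-map [H/K -> X] exactly when some
    point of [X] has isotropy group [K] in [H] ([coset_embedsP]). The admissible
    pairs of the Steiner operad of a universe [U] are those for which [H/K] embeds
    in [U] in this sense ([steiner_transferP]). One direction evaluates a fixed
    configuration of paths at the origin; the other joins the identity to maps
    that shrink a representation to small balls around the points of an orbit, by
    the family [v |-> v / (1 + s |v|)], whose members are distance-reducing with
    an explicit inverse, and which is the identity for [s = 0].

    It remains to compare isotropy groups. A vector [u] of a representation is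
    fixed by [h] if and only if all its irreducible components are. The isotropy
    group of each component [v], in an irreducible representation [V], is either
    the whole group or the first member of a pair in [Orb V]. In a transfer system,
    the subgroups [P] with [P -> G] are closed under intersection, and [P -> G]
    restricts to [P :&: H -> H]. Hence a transfer system that contains the
    relations [Orb V] for the components of [u] relates the isotropy group of [u]
    in [H] to [H] ([transfer_of_stabilizers]).

    For a given universe, Maschke's theorem applied to the finite dimensional
    representations generated by one point for each admissible pair provides the
    irreducible representations ([universe_transfer_generated]). For given
    representations, the universe is the direct sum of all of them and of a trivial
    line, tensored with the space of polynomials; multiplication by powers of the
    variable provides orthogonal copies of subrepresentations, and also shows that
    the isotropy relation is transitive ([universe_exists],
    [generated_transfer_universe]). *)

(** * Orthogonal representations from invariant inner products *)

Section InnerProductSpace.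
Variables (R : realType) (L : lmodType R) (form : L -> L -> R).
Hypotheses (formPl : forall w a u v,
              form (a *: u + v) w = a * form u w + form v w)
           (formC : forall u v, form u v = form v u)
           (form_gt0 : forall u, u != 0 -> 0 < form u u).

Let form0l v : form 0 v = 0.
Proof. by have := formPl v (-1) 0 0; rewrite scaler0 addr0; lra. Qed.

Let formDl u v w : form (u + v) w = form u w + form v w.
Proof. by rewrite -[u in LHS]scale1r formPl mul1r. Qed.

Let formZl a u w : form (a *: u) w = a * form u w.
Proof. by rewrite -[a *: u]addr0 formPl form0l addr0. Qed.

Let form_ge0 u : 0 <= form u u.
Proof. by have [->|/form_gt0/ltW//] := eqVneq u 0; rewrite form0l. Qed.

Let formDD a u v :
  form (a *: u + v) (a *: u + v) = a ^+ 2 * form u u + 2 * a * form u v + form v v.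
Proof.
rewrite !(formDl, formZl) ![form _ (_ + _)]formC !(formDl, formZl).
by rewrite [form v u]formC; ring.
Qed.

Let cauchy_schwarz u v : form u v ^+ 2 <= form u u * form v v.
Proof.
have [->|/form_gt0 v0] := eqVneq v 0.
  by rewrite formC !form0l expr0n mulr0.
have := form_ge0 (- (form u v / form v v) *: v + u).
rewrite formDD [form v u]formC -(pmulr_lge0 _ v0).
have e : form v v != 0 by rewrite gt_eqF.
suff -> : ((- (form u v / form v v)) ^+ 2 * form v v +
   2 * - (form u v / form v v) * form u v + form u u) * form v v =
   form u u * form v v - form u v ^+ 2 by rewrite subr_ge0.
by field.
Qed.

Let norm u := Num.sqrt (form u u).

Let normD u v : norm (u + v) <= norm u + norm v.
Proof.
rewrite -ler_sqr ?nnegrE ?addr_ge0 ?sqrtr_ge0// sqrrD !sqr_sqrtr//.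
rewrite -{1 2}[u]scale1r formDD expr1n !mul1r mulr1.
have : form u v <= norm u * norm v.
  rewrite -sqrtrM// (le_trans (ler_norm _))// -sqrtr_sqr.
  by rewrite ler_wsqrtr.
lra.
Qed.

Let normZ a u : norm (a *: u) = `|a| * norm u.
Proof.
rewrite /norm -[a *: u]addr0 formDD [form u 0]formC !form0l mulr0 !addr0.
by rewrite sqrtrM ?sqr_ge0// sqrtr_sqr.
Qed.

Let norm_eq0 u : norm u = 0 -> u = 0.
Proof.
move/eqP; rewrite sqrtr_eq0; apply: contraTeq => /form_gt0.
by rewrite ltNge.
Qed.

(** The three laws of the form are arguments of the type, so that the norm they
    give can be attached to this copy of [L] by instance resolution. *)
Definition normed_copy of (forall w a u v,
  form (a *: u + v) w = a * form u w + form v w) &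
  (forall u v, form u v = form v u) &
  (forall u, u != 0 -> 0 < form u u) : Type := L.

Local Notation E := (normed_copy formPl formC form_gt0).

HB.instance Definition _ := GRing.Lmodule.copy E L.
HB.instance Definition _ := Lmodule_isNormed.Build R E normD normZ norm_eq0.

Let bil : bilinear_for *%R (idfun \; *%R) (form : E -> E -> R).
Proof.
by split=> u a v w /=; rewrite ?formPl// formC formPl ![form _ u]formC.
Qed.

HB.instance Definition _ :=
  bilinear_isBilinear.Build R E E R *%R (idfun \; *%R) (form : E -> E -> R) bil.
HB.instance Definition _ := isHermitianSesquilinear.Build R E false idfun
  (form : E -> E -> R) (fun u v => etrans (formC u v) (esym (mul1r _))).
HB.instance Definition _ := isDotProduct.Build R E (form : E -> E -> R) form_gt0.

(** Orthogonal representations can be specified by an invariant inner product on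
    a bare real vector space: the norm and its topology come for free. *)
Lemma orth_rep_of (gT : finGroupType) (act : gT -> {linear L -> L}) :
    (forall v, act 1%g v = v) ->
    (forall g h v, act (g * h)%g v = act g (act h v)) ->
    (forall g v w, form (act g v) (act g w) = form v w) ->
  exists (V : orth_rep R gT) (e : {linear L -> V}) (e' : {linear V -> L}),
    [/\ cancel e e', cancel e' e,
        forall v w, rep_dot (e v) (e w) = form v w
      & forall g v, e (act g v) = rep_act g (e v)].
Proof.
move=> act1 actM actI.
pose dt : {dot E for idfun} := (form : E -> E -> R).
have dn (v : E) : dt v v = `|v| ^+ 2 by rewrite /Num.norm/= sqr_sqrtr.
exists (@OrthRep R gT E dt act dn act1 actM actI).
by exists idfun, idfun; split.
Qed.

End InnerProductSpace.

(** * Isotropy groups and transfer systems *)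

Section Stabilizers.
Variables (gT : finGroupType) (X : Type) (a : gT -> X -> X).
Hypotheses (a1 : forall x, a 1%g x = x)
           (aM : forall g h x, a (g * h)%g x = a g (a h x)).
Implicit Types K H : {group gT}.

(** An equivariant map out of [H/K] is determined by the image of the coset [K],
    and it is well defined and injective exactly when that image has isotropy
    group [K] in [H]. *)
Lemma coset_embedsP K H : K \subset H ->
  coset_embeds a K H <-> exists x, {in H, forall h, a h x = x <-> h \in K}.
Proof.
move=> sKH; split=> [[f [injf eqf]]|[x stabx]].
  have KK : (K : {set gT}) \in lcosets K H.
    by apply/lcosetsP; exists 1%g; rewrite ?group1 ?lcoset1.
  exists (f K) => h Hh; rewrite -eqf//; split=> [|Kh].
    have hK : (h *: K)%g \in lcosets K H by apply/lcosetsP; exists h.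
    by move=> /(injf _ _ hK KK) <-; rewrite lcoset_refl.
  by rewrite lcoset_id.
have repE h : h \in H -> a (repr (h *: K)%g) x = a h x.
  move=> Hh; have /lcosetP[k Kk ->] := mem_repr _ (lcoset_refl K h).
  rewrite aM; congr (a h _); apply/stabx => //.
  exact: (fintype.subsetP sKH).
exists (fun A => a (repr A) x); split=> [A B|h A Hh].
  move=> /lcosetsP[h Hh ->] /lcosetsP[g Hg ->]; rewrite !repE// => e.
  apply/lcoset_eqP; rewrite mem_lcoset; apply/stabx; first by rewrite groupM ?groupV.
  by rewrite aM e -aM mulVg a1.
move=> /lcosetsP[g Hg ->]; rewrite -lcosetM !repE ?aM//.
by rewrite groupM.
Qed.

Lemma stab_group_set x : group_set [set h | `[< a h x = x >]].
Proof.
apply/group_setP; split=> [|g h]; first by rewrite finset.inE; apply/asboolP/a1.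
by rewrite !inE => gx hx; rewrite aM hx.
Qed.

Definition stab_group x := Group (stab_group_set x).

Lemma stab_groupP x h : reflect (a h x = x) (h \in stab_group x).
Proof. by rewrite finset.inE; apply: asboolP. Qed.

Definition point_transfer K H : Prop :=
  K \subset H /\ exists x, {in H, forall h, a h x = x <-> h \in K}.

(** Transitivity is the only axiom with content: if [L] is the isotropy group in
    [K] of [x] and [K] is the isotropy group in [H] of [y], then [L] is the
    isotropy group in [H] of the pair of [x] and [y], which therefore has to be
    realized by a single point [z]. *)
Lemma point_transfer_system :
    (exists x, forall h, a h x = x) ->
    (forall x y, exists z, forall h, a h z = z <-> a h x = x /\ a h y = y) ->
  transfer_system point_transfer.
Proof.
move=> [x0 fix_x0] pairing; split.
- by move=> H; split=> //; exists x0 => h Hh.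
- move=> K H [sKH _] [sHK _]; apply/val_inj/eqP.
  by rewrite finset.eqEsubset sKH.
- move=> L K H [sLK [x stabx]] [sKH [y staby]].
  split; first exact: fintype.subset_trans sKH.
  have [z stabz] := pairing x y; exists z => h Hh; rewrite stabz staby//.
  split=> [[hx Kh]|Lh]; first by apply/stabx.
  by have Kh := fintype.subsetP sLK _ Lh; split=> //; apply/stabx.
- by move=> K H [].
- move=> K H g [sKH [x stabx]]; split; first by rewrite conjSg.
  exists (a g x) => h; rewrite /= !mem_conjg invgK => /stabx <-.
  rewrite -aM; split=> e.
    by rewrite conjgE aM e -aM mulVg a1.
  by rewrite -{2}e -aM conjgE mulKVg.
- move=> K H L [sKH [x stabx]] sLH; split; first exact: subsetIr.
  exists x => h Lh; rewrite finset.inE Lh andbT; apply: stabx.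
  exact: fintype.subsetP Lh.
Qed.

End Stabilizers.

Section MatrixRepresentations.
Variables (R : realType) (gT : finGroupType).
Implicit Types K H : {group gT}.

Section Action.
Variables (d : nat) (rG : mx_representation R [set: gT] d).

Lemma repr_act1 v : repr_act rG 1%g v = v.
Proof. by rewrite /repr_act invg1 repr_mx1 mulmx1. Qed.

Lemma repr_actM g h v :
  repr_act rG (g * h)%g v = repr_act rG g (repr_act rG h v).
Proof. by rewrite /repr_act invMg repr_mxM ?inE// mulmxA. Qed.

Lemma repr_act_is_linear g : linear (repr_act rG g).
Proof. by move=> c u v; rewrite /repr_act mulmxDl scalemxAl. Qed.

HB.instance Definition _ g :=
  GRing.isLinear.Build R 'rV_d 'rV_d *:%R (repr_act rG g) (@repr_act_is_linear g).

Lemma OrbP K : Orb rG K [set: gT]%G <->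
  K \proper [set: gT] /\ exists v, forall h, repr_act rG h v = v <-> h \in K.
Proof.
have EP := coset_embedsP repr_act1 repr_actM (finset.subsetT K).
split=> [[_ pK /EP[v stabv]]|[pK [v stabv]]]; split=> //.
  by exists v => h; apply: stabv; rewrite finset.inE.
by apply/EP; exists v => h _.
Qed.

End Action.

(** The converse of the fact that points of [V j] give admissible subgroups of
    the whole group. Each isotropy group [S j] satisfies [T (S j) G]; restricting
    [S j -> G] to [P] gives [S j :&: P -> P], so that the class of subgroups [P]
    with [P -> G] is closed under intersection, and a last restriction to [H]
    yields [K -> H]. *)
Lemma transfer_of_stabilizers (T : {group gT} -> {group gT} -> Prop)
    (J : finType) (d : J -> nat)
    (V : forall j, mx_representation R [set: gT] (d j))
    (v : forall j, 'rV[R]_(d j)) K H :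
    transfer_system T ->
    (forall j K', Orb (V j) K' [set: gT]%G -> T K' [set: gT]%G) ->
    K \subset H ->
    {in H, forall h, h \in K <-> forall j, repr_act (V j) h (v j) = v j} ->
  T K H.
Proof.
move=> tT OT sKH stabK.
pose S j := stab_group (@repr_act1 _ (V j)) (@repr_actM _ (V j)) (v j).
have SP j h : reflect (repr_act (V j) h (v j) = v j) (h \in S j).
  exact: stab_groupP.
have TS j : T (S j) [set: gT]%G.
  have [pS|] := boolP (S j \proper [set: gT]).
    by apply: OT; apply/OrbP; split=> //; exists (v j) => h; split=> /SP.
  rewrite finset.properT negbK => /eqP ST.
  by rewrite (_ : S j = [set: gT]%G); [apply: transfer_refl | apply/val_inj].
have [P TP PP] : exists2 P : {group gT}, T P [set: gT]%G
    & forall h, h \in P = all (fun j => h \in S j) (enum J).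
  elim: (enum J) => [|j s [P TP PP]].
    by exists [set: gT]%G => [|h]; [apply: transfer_refl | rewrite finset.inE].
  exists (S j :&: P)%G => [|h]; last by rewrite finset.inE PP.
  apply: transfer_trans (TP) => //.
  by apply: (transfer_res tT (TS j)); rewrite finset.subsetT.
have -> : K = (P :&: H)%G.
  apply/val_inj/finset.setP => h /=; rewrite finset.inE PP.
  have [Hh|nHh] := boolP (h \in H); last first.
    by rewrite andbF; apply: contraNF nHh => /(fintype.subsetP sKH).
  rewrite andbT; apply/idP/allP => [Kh j _|Sh].
    by apply/SP; apply: (stabK h Hh).1.
  by apply/(stabK h Hh) => j; apply/SP/Sh; rewrite mem_enum.
by apply: (transfer_res tT TP); rewrite finset.subsetT.
Qed.

End MatrixRepresentations.

(** * Finite dimensional models of the span of an orbit *)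

Section CyclicModel.
Variables (R : realType) (gT : finGroupType) (U : orth_rep R gT).
Local Notation G := [set: gT]%G.

Definition equivariant d (rG : mx_representation R G d) (psi : 'rV[R]_d -> U) :=
  forall g v, psi (repr_act rG g v) = rep_act g (psi v).

(** The linear extension of [x |-> x^-1 u] to the regular representation; the
    inverse compensates for the right action of matrices on row vectors. *)
Definition regular_orbit_map (u : U) (v : 'rV[R]_(gcard G)) : U :=
  \sum_i v 0 i *: rep_act (enum_val i)^-1%g u.

Lemma regular_orbit_map_is_linear u : linear (regular_orbit_map u).
Proof.
move=> c v w; rewrite /regular_orbit_map scaler_sumr -big_split/=.
by apply: eq_bigr => i _; rewrite !mxE scalerDl scalerA.
Qed.

HB.instance Definition _ u := GRing.isLinear.Build R 'rV[R]_(gcard G) U *:%R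
  (regular_orbit_map u) (regular_orbit_map_is_linear u).

Lemma regular_orbit_map_delta u i :
  regular_orbit_map u (delta_mx 0 i) = rep_act (enum_val i)^-1%g u.
Proof.
rewrite /regular_orbit_map (bigD1 i)//= mxE !eqxx scale1r big1 ?addr0// => j ji.
by rewrite mxE (negPf ji) andbF scale0r.
Qed.

Lemma regular_orbit_map_equivariant u :
  equivariant (regular_repr R G) (regular_orbit_map u).
Proof.
move=> g v; move: (fun i => v 0 i) (row_sum_delta v) => a ->.
rewrite (linear_sum (repr_act (regular_repr R G) g)).
rewrite !(linear_sum (regular_orbit_map u)) linear_sum; apply: eq_bigr => i _.
rewrite (linearZ_LR (repr_act (regular_repr R G) g)).
rewrite !(linearZ_LR (regular_orbit_map u)) linearZ_LR/=.
rewrite regular_orbit_map_delta; congr (_ *: _).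
rewrite /repr_act /= -rowE rowK regular_orbit_map_delta gring_indexK ?finset.inE//.
by rewrite invMg invgK rep_actM.
Qed.

Lemma pchar_group : ([pchar R]^'.-group G)%g.
Proof. by rewrite /pgroup pcharf'_nat pnatr_eq0 -lt0n cardG_gt0. Qed.

(** As long as the map has a nonzero kernel, the kernel contains a cyclic
    submodule, and by Maschke's theorem the source can be replaced by a
    complement of it without losing the given value; the dimension drops. *)
Lemma equivariant_model_injective d (rG : mx_representation R G d)
    (psi : {linear 'rV[R]_d -> U}) c :
    equivariant rG psi ->
  exists (d' : nat) (rG' : mx_representation R G d')
         (psi' : {linear 'rV[R]_d' -> U}) (c' : 'rV[R]_d'),
    [/\ injective psi', equivariant rG' psi' & psi' c' = psi c].
Proof.
have [m] := ubnP d; elim: m => // m IHm in d rG psi c *; rewrite ltnS => dm eqv.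
have [injpsi|] := pselect (injective psi); first by exists d, rG, psi, c.
move=> ninj; have [w w0 psiw] : exists2 w, w != 0 & psi w = 0.
  apply: contrapT => nw; apply: ninj => v w vw; apply: contrapT => /eqP vnw.
  by apply: nw; exists (v - w); rewrite ?subr_eq0// linearB/= vw subrr.
have [W modW defW dxW] := mx_Maschke_pchar rG pchar_group
  (cyclic_mx_module rG w) (submx1 _).
have /sub_addsmxP[[a b] /= cE] : (c <= cyclic_mx rG w + W)%MS.
  by rewrite defW submx1.
have psi0 : psi (a *m cyclic_mx rG w) = 0.
  have /cyclic_mxP[A /envelop_mxP[x ->] ->] := submxMl a (cyclic_mx rG w).
  rewrite mulmx_sumr linear_sum big1// => g _.
  by rewrite -scalemxAr linearZ/= -[g]invgK -/(repr_act rG _ _) eqv psiw !linear0.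
have ltW : (\rank W < m)%N.
  apply: leq_trans dm; move: (mxdirectP dxW) => /=.
  have := cyclic_mx_eq0 rG w; rewrite -mxrank_eq0 (negPf w0) defW mxrank1.
  by move/negbT; lia.
have [|d' [rG' [psi' [c' [inj' eqv' psic']]]]] :=
   IHm _ (submod_repr modW) (psi \o val_submod) (in_submod W (b *m W)) ltW.
  by move=> g v; rewrite /= /repr_act val_submodJ ?finset.inE// -eqv.
exists d', rG', psi', c'; split=> //; rewrite psic' /= in_submodK ?submxMl//.
by rewrite cE linearD/= psi0 add0r.
Qed.

(** The span of an orbit in a possibly infinite dimensional representation, as a
    matrix representation: shrink the map from the regular representation. *)
Lemma cyclic_model (u : U) :
  exists (d : nat) (rG : mx_representation R G d)
         (psi : {linear 'rV[R]_d -> U}) (c : 'rV[R]_d),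
    [/\ injective psi, equivariant rG psi & psi c = u].
Proof.
have [d [rG [psi [c [? ? cE]]]]] := equivariant_model_injective
  (delta_mx 0 (gring_index G 1)) (@regular_orbit_map_equivariant u).
exists d, rG, psi, c; split=> //; rewrite cE /= regular_orbit_map_delta.
by rewrite gring_indexK ?group1// invg1 rep_act1.
Qed.

End CyclicModel.

(** * Steiner paths that shrink a representation to a ball *)

Section RadialContraction.
Variables (R : realType) (V : normedModType R).
Implicit Types (s : R) (v w y : V).

(** For [s > 0], a homeomorphism onto the open ball of radius [s^-1]; for [s = 0],
    the identity. The inverse is [u |-> (1 - s |u|)^-1 u]. *)
Definition radial s v : V := (1 + s * `|v|)^-1 *: v.

Lemma radial0 v : radial 0 v = v.
Proof. by rewrite /radial mul0r addr0 invr1 scale1r. Qed.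

Let den_gt0 s v : 0 <= s -> 0 < 1 + s * `|v|.
Proof. by move=> s0; rewrite ltr_pwDl// mulr_ge0. Qed.

Lemma radial_norm s v : 0 <= s -> s * `|radial s v| = 1 - (1 + s * `|v|)^-1.
Proof.
move=> s0; have d0 := den_gt0 v s0.
rewrite normrZ gtr0_norm ?invr_gt0//.
by field; rewrite gt_eqF.
Qed.

Lemma radial_norm_lt1 s v : 0 <= s -> s * `|radial s v| < 1.
Proof. by move=> s0; rewrite radial_norm// gtrBl invr_gt0 den_gt0. Qed.

Lemma radialK s v : 0 <= s -> (1 - s * `|radial s v|)^-1 *: radial s v = v.
Proof.
move=> s0; rewrite radial_norm// opprB addrC subrK invrK.
by rewrite scalerA mulfV ?scale1r// gt_eqF// den_gt0.
Qed.

(** With [a] and [b] the two scaling factors, split the difference as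
    [a (v - w) - (b - a) w] where [w] is the shorter vector. As
    [b - a = a b s (|v| - |w|)], it is at most
    [a (1 + b s |w|) |v - w|], and [a (1 + b s |w|) <= 1] because [|w| <= |v|]. *)
Lemma radial_lipschitz s v w :
  0 <= s -> `|radial s v - radial s w| <= `|v - w|.
Proof.
move=> s0; wlog vw : v w / `|w| <= `|v|.
  by move=> H; case/orP: (le_total `|w| `|v|) => /H//; rewrite distrC [leRHS]distrC.
have [v0 w0] := (den_gt0 v s0, den_gt0 w s0).
set a := (1 + s * `|v|)^-1; set b := (1 + s * `|w|)^-1.
have a0 : 0 < a by rewrite invr_gt0.
have b0 : 0 < b by rewrite invr_gt0.
have abE : b - a = a * b * (s * (`|v| - `|w|)).
  by rewrite /a /b; field; rewrite !gt_eqF.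
have -> : radial s v - radial s w = a *: (v - w) - (b - a) *: w.
  by rewrite /radial -/a -/b scalerBr scalerBl opprB addrA subrK.
apply: le_trans (ler_normB _ _) _; rewrite !normrZ gtr0_norm// ger0_norm; last first.
  by rewrite abE !mulr_ge0 ?subr_ge0// ltW.
have dvw : `|v| - `|w| <= `|v - w| by apply: lerB_dist.
have aE : a + a * b * s * `|w| <= 1.
  rewrite -subr_ge0.
  have -> : 1 - (a + a * b * s * `|w|) =
            a * b * (s * (`|v| - `|w|) + s * `|v| * (s * `|w|)).
    by rewrite /a /b; field; rewrite !gt_eqF.
  by rewrite !mulr_ge0 ?addr_ge0 ?mulr_ge0 ?subr_ge0// ltW.
apply: le_trans (_ : (a + a * b * s * `|w|) * `|v - w| <= _); last first.
  by rewrite ler_piMl.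
rewrite abE mulrDl lerD2l.
have -> : a * b * (s * (`|v| - `|w|)) * `|w| = a * b * s * `|w| * (`|v| - `|w|).
  by ring.
by rewrite ler_wpM2l// !mulr_ge0// ltW.
Qed.

End RadialContraction.

Section SteinerConfiguration.
Local Open Scope classical_set_scope.
Variables (R : realType) (gT : finGroupType) (V : orth_rep R gT).

(** For [s > 0], a path from an embedding of [V] onto the ball of radius [s^-1]
    around [y], at [t = 0], to the identity, at [t = 1]. The absolute value makes the formula
    continuous, and an embedding, for all real [t]. *)
Definition shrink_path (s : R) (y : V) (t : R) (v : V) : V :=
  (1 - t) *: y + radial (`|1 - t| * s) v.

Lemma shrink_path_continuous s y : 0 <= s ->
  continuous (shrink_path s y : R -> {compact-open, V -> V}).
Proof.
move=> s0; apply: (@continuous_curry_fun _ _ _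
  (fun p : R * V => shrink_path s y p.1 p.2)) => p.
apply: cvgD.
  apply: cvgZ; last exact: cvg_cst.
  by apply: cvgB; [exact: cvg_cst|exact: cvg_fst].
apply: cvgZ; last exact: cvg_snd.
apply: cvgV.
  by rewrite gt_eqF// ltr_pwDl// !mulr_ge0.
apply: cvgD; first exact: cvg_cst.
apply: cvgM; last by apply: cvg_norm; exact: cvg_snd.
apply: cvgM; last exact: cvg_cst.
apply: cvg_norm; apply: cvgB; [exact: cvg_cst|exact: cvg_fst].
Qed.

(** The inverse [g] of the contraction is continuous where [s |u - y| < 1], an
    open set that contains the image. *)
Lemma shrink_embedding (y : V) s : 0 <= s ->
  topological_embedding (fun v => y + radial s v).
Proof.
move=> s0; set f := fun v => _.
pose g u := (1 - s * `|u - y|)^-1 *: (u - y).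
have fy v : f v - y = radial s v by rewrite /f addrC addKr.
have fK : cancel f g by move=> v; rewrite /g fy radialK.
split; first exact: can_inj fK.
  move=> v; apply: cvgD; first exact: cvg_cst.
  apply: cvgZ; last exact: cvg_id.
  apply: cvgV; first by rewrite gt_eqF// ltr_pwDl// mulr_ge0.
  apply: cvgD; first exact: cvg_cst.
  apply: cvgM; first exact: cvg_cst.
  by apply: cvg_norm; exact: cvg_id.
move=> A openA.
have h_cont : continuous (fun u : V => 1 - s * `|u - y|).
  move=> u; apply: cvgB; first exact: cvg_cst.
  apply: cvgM; first exact: cvg_cst.
  apply: cvg_norm; apply: cvgB; [exact: cvg_id|exact: cvg_cst].
exists [set u | 0 < 1 - s * `|u - y| /\ A (g u)].
  rewrite openE => u [u0 Au].
  have hu : \forall z \near u, 0 < 1 - s * `|z - y|.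
    exact: (cvgr_gt _ (h_cont u)).
  have gu : g z @[z --> u] --> g u.
    apply: cvgZ; last by apply: cvgB; [exact: cvg_id|exact: cvg_cst].
    by apply: cvgV; [rewrite gt_eqF | exact: h_cont].
  have Agu : \forall z \near u, A (g z).
    by apply: gu; exact: open_nbhs_nbhs.
  by apply: filterS2 hu Agu => z; split.
apply/seteqP; split => v /=; first by case=> _; rewrite fK.
by move=> Av; rewrite fK; split=> //; rewrite fy subr_gt0 radial_norm_lt1.
Qed.

Lemma shrink_path_steiner s y : 0 <= s -> steiner_path (shrink_path s y).
Proof.
move=> s0; split=> [|t _|v].
- exact/continuous_subspaceT/shrink_path_continuous.
- have ts0 : 0 <= `|1 - t| * s by rewrite mulr_ge0.
  split=> [|v w]; first exact: shrink_embedding.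
  by rewrite /shrink_path opprD addrACA subrr add0r radial_lipschitz.
- by rewrite /shrink_path subrr normr0 mul0r radial0 scale0r add0r.
Qed.

Lemma shrink_path_equivariant s (g : gT) (y : V) t v :
  rep_act g (shrink_path s y t (rep_act g^-1%g v)) =
  shrink_path s (rep_act g y) t v.
Proof.
have normg w : `|rep_act g w| = `|w|.
  apply: (@pexpIrn _ 2); rewrite ?nnegrE//.
  by rewrite -!rep_dot_norm rep_act_isom.
rewrite /shrink_path /radial linearD !linearZ/= -rep_actM mulgV rep_act1.
congr (_ + (_ + _ * _)^-1 *: _).
by rewrite -[v in RHS](@rep_act1 _ _ V) -{1}(mulgV g) rep_actM normg.
Qed.

(** Shrink [V] onto balls around the points [y m], all of the same radius and so
    small that they are disjoint: the parameter [s] is a sum that dominates each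
    [2 / |y m - y m'|]. As the balls have equal radii, an isometry that permutes
    the centres permutes the paths. *)
Lemma steiner_configuration n (y : 'I_n -> V) : injective y ->
  exists2 x : 'I_n -> R -> V -> V, steiner x &
    forall g (sigma : 'S_n), (forall m, y (sigma m) = rep_act g (y m)) ->
      forall m t v, steiner_act (g, sigma) x m t v = x m t v.
Proof.
move=> injy.
pose s := \sum_(p : 'I_n * 'I_n) 2 / `|y p.1 - y p.2|.
have s0 : 0 <= s by apply: sumr_ge0 => p _; rewrite divr_ge0.
exists (fun m => shrink_path s (y m)).
  split=> [m|m m' mm' v w]; first exact: shrink_path_steiner.
  rewrite /shrink_path subr0 !scale1r normr1 mul1r.
  set a := radial s v; set b := radial s w.
  have ym0 : 0 < `|y m - y m'|.
    by rewrite normr_gt0 subr_eq0; apply: contra mm' => /eqP/injy ->.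
  have sy : 2 <= s * `|y m - y m'|.
    rewrite -ler_pdivrMr// /s (bigD1 (m, m'))//= lerDl.
    by apply: sumr_ge0 => p _; rewrite divr_ge0.
  apply/eqP => /(congr1 (fun z => z - a - y m')).
  rewrite addrK [y m' + b - a - y m']addrC !addrA addNr add0r => yab.
  have : `|y m - y m'| <= `|b| + `|a| by rewrite yab ler_normB.
  move/(ler_wpM2l s0); rewrite mulrDr.
  have := radial_norm_lt1 v s0; have := radial_norm_lt1 w s0.
  rewrite -/a -/b; lra.
move=> g sigma ysig m t v.
by rewrite /steiner_act /= shrink_path_equivariant -ysig permKV.
Qed.

End SteinerConfiguration.

(** * Admissibility for the Steiner operad is a condition on isotropy groups *)

Section SteinerTransfer.
Variables (R : realType) (gT : finGroupType).
Implicit Types (U V W : orth_rep R gT) (K H : {group gT}).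
Local Notation G := [set: gT]%G.

Lemma rep_dot_eq0 V (v : V) : rep_dot v v = 0 -> v = 0.
Proof. by rewrite rep_dot_norm => /eqP; rewrite expf_eq0/= normr_eq0 => /eqP. Qed.

Lemma subrep_injective V W (i : {linear V -> W}) : subrep i -> injective i.
Proof.
move=> [dot_i _] v w vw; apply/eqP; rewrite -subr_eq0; apply/eqP/rep_dot_eq0.
by rewrite -dot_i linearB vw subrr -(scale0r (0 : W)) linearZ/= mul0r.
Qed.

(** Two points of [K(V)(n)] that agree in the colimit agree in some larger
    [K(W)(n)], and the product with the identity of the complement of [V]
    restricts on [V] to the original paths. *)
Lemma steiner_colim_eq_same U n V (i : {linear V -> U})
    (x x' : 'I_n -> R -> V -> V) :
    subrep i -> steiner_colim_eq i x i x' ->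
  forall m t, t \in `[0, 1] -> x m t =1 x' m t.
Proof.
move=> /subrep_injective inji [W [k [j [j' [[_ /subrep_injective injk kj kj'] ]]]]].
move=> [z [_ zx zx']] m t t01 v; apply: inji; rewrite -kj -kj'/=.
have jj' w : j w = j' w by apply: injk; have /= -> := kj w; have /= -> := kj' w.
have dot0 (w : W) : rep_dot w (0 : W) = 0.
  by rewrite -(scale0r (0 : W)) linearZ/= mul0r.
have /eqP := zx m t t01 v 0 (fun _ => dot0 _).
rewrite jj' zx'// !addr0 => /eqP <-; by rewrite -jj'.
Qed.

Lemma finite_dim_sub V d (e : {linear 'rV[R]_d -> V}) (e' : V -> 'rV[R]_d) :
  cancel e' e -> finite_dim V.
Proof.
move=> e'K; exists d, (fun i => e (delta_mx 0 i)) => v; exists (e' v 0).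
rewrite -{1}(e'K v) {1}[e' v]row_sum_delta linear_sum.
by apply: eq_bigr => i _; rewrite linearZ.
Qed.

(** Pulling the inner product back along an injective equivariant map from
    row vectors avoids the construction of the span of an orbit as a subspace. *)
Lemma subrep_through U (u : U) : exists (V : orth_rep R gT) (i : {linear V -> U}),
  [/\ finite_dim V, subrep i & exists v, i v = u].
Proof.
have [d [rG [psi [c [inj_psi eqv psic]]]]] := cyclic_model u.
pose form v w := rep_dot (psi v) (psi w).
have formPl w a v v' : form (a *: v + v') w = a * form v w + form v' w.
  by rewrite /form linearP linearPl.
have formC v w : form v w = form w v.
  by rewrite /form hermitian_subproof expr0 mul1r.
have form_gt0 v : v != 0 -> 0 < form v v.
  move=> v0; have psiv0 : psi v != 0.
    by apply: contra_neq v0 => psiv; apply: inj_psi; rewrite psiv linear0.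
  exact: neq0_dnorm_gt0 psiv0.
have formI g v w : form (repr_act rG g v) (repr_act rG g w) = form v w.
  by rewrite /form !eqv rep_act_isom.
have [V [e [e' [eK e'K dot_e eqv_e]]]] := orth_rep_of formPl formC form_gt0
  (act := fun g => repr_act rG g) (@repr_act1 _ _ _ rG) (@repr_actM _ _ _ rG) formI.
exists V, (psi \o e'); split; first exact: finite_dim_sub e'K.
- split=> [v w|g v] /=; first by rewrite -[LHS]dot_e !e'K.
  by rewrite -eqv -{1}(e'K v) -eqv_e eK.
- by exists (e c); rewrite /= eK.
Qed.

(** Number the cosets and let [H] permute them by left translation. *)
Lemma coset_perm_rep_exists K H : K \subset H ->
  exists sigma : gT -> 'S_(#|H : K|%g), coset_perm_rep K H sigma.
Proof.
move=> sKH; have cardE : #|H : K|%g = #|lcosets K H| by rewrite card_lcosets.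
pose b (m : 'I_(#|H : K|%g)) := enum_val (cast_ord cardE m).
have injb : injective b.
  by move=> m m'; move/enum_val_inj/cast_ord_inj.
have b_in m : b m \in lcosets K H by exact: enum_valP.
have b_onto A : A \in lcosets K H -> exists m, b m = A.
  move=> AH; exists (cast_ord (esym cardE) (enum_rank_in AH A)).
  by rewrite /b cast_ordKV enum_rankK_in.
have perm_of h : exists s : 'S_(#|H : K|%g),
    h \in H -> forall m, b (s m) = (h *: b m)%g.
  have [Hh|nHh] := boolP (h \in H); last by exists 1%g.
  have /choice[f fE] m : exists m', b m' = (h *: b m)%g.
    apply: b_onto; have /lcosetsP[g Hg ->] := b_in m.
    by apply/lcosetsP; exists (h * g)%g; rewrite ?groupM// lcosetM.
  have injf : injective f.
    by move=> m m' /(congr1 b); rewrite !fE => /lcoset_inj/injb.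
  by exists (perm injf) => _ m; rewrite permE.
have [sigma sigmaE] := choice perm_of.
exists sigma, b; split=> //.
apply/finset.setP => A; apply/imsetP/idP => [[m _ ->]//|/b_onto[m <-]].
by exists m.
Qed.

(** The theorem of Blumberg and Hill. From a fixed configuration of paths, the
    images [h_m(0)(0)] of the origin are distinct and [H] permutes them as the
    cosets of [K], so that the one indexed by the coset [K] has isotropy group
    [K]. From a point with isotropy group [K] in [H], its orbit in a finite
    dimensional subrepresentation is the set of centres of a configuration of
    shrinking paths. *)
Lemma steiner_transferP U K H :
  steiner_transfer U K H <-> point_transfer (fun g (u : U) => rep_act g u) K H.
Proof.
split=> -[sKH].
  move=> [sigma [[b [injb bE bsig]] [V [i [x [_ subi [_ xdisj] xfix]]]]]].
  split=> //.
  have y_eq h m : h \in H -> x (sigma h m) 0 0 = rep_act h (x m 0 0).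
    move=> Hh; have hG : (h, sigma h) \in graph_subgroup H sigma by apply: imset_f.
    have <- := steiner_colim_eq_same subi (xfix _ hG) (sigma h m) _ 0.
      by rewrite /steiner_act/= permK linear0.
    by rewrite in_itv/= lexx ler01.
  have [m0 bm0] : exists m, b m = K.
    have : (K : {set gT}) \in lcosets K H.
      by apply/lcosetsP; exists 1%g; rewrite ?group1 ?lcoset1.
    by rewrite -bE => /imsetP[m _ Kbm]; exists m.
  exists (i (x m0 0 0)) => h Hh; rewrite -(proj2 subi) -y_eq//.
  split=> [/(subrep_injective subi) e|Kh].
    have [/(congr1 b)|/xdisj] := eqVneq (sigma h m0) m0; last first.
      by move=> /(_ 0 0); rewrite e eqxx.
    by rewrite bsig// bm0 => <-; rewrite lcoset_refl.
  congr (i (x _ 0 0)); apply: injb; rewrite bsig// bm0.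
  by rewrite lcoset_id.
move=> [u stabu]; split=> //.
have [sigma sigmaP] := coset_perm_rep_exists sKH.
exists sigma; split=> //; have [b [injb bE bsig]] := sigmaP.
have [V [i [fdV subi [v iv]]]] := subrep_through u.
have /(coset_embedsP (@rep_act1 _ _ V) (@rep_actM _ _ V) sKH)[f [injf eqf]] :
    exists v : V, {in H, forall h, rep_act h v = v <-> h \in K}.
  exists v => h Hh; rewrite -(stabu h Hh) -iv -(proj2 subi); split=> [->//|].
  exact: subrep_injective.
have b_in m : b m \in lcosets K H by rewrite -bE imset_f.
have injy : injective (f \o b) by move=> m m' /= /(injf _ _ (b_in _) (b_in _))/injb.
have [x xs xfix] := steiner_configuration injy.
exists V, i, x; split=> // p /imsetP[h Hh ->].
(* The configuration is fixed on the nose, so the colimit relation is witnessed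
   by [V] itself. *)
have xE : steiner_act (h, sigma h) x = x.
  apply/funext => m; apply/funext => t; apply/funext => w; apply: xfix => m'.
  by rewrite /= bsig// eqf.
exists V, i, idfun, idfun; split; first by split.
exists x; split; rewrite ?xE//.
  move=> m t _ w w' ow'; rewrite (_ : w' = 0) ?addr0//; exact/rep_dot_eq0/ow'.
move=> m t _ w w' ow'; rewrite (_ : w' = 0) ?addr0//; exact/rep_dot_eq0/ow'.
Qed.

End SteinerTransfer.

(** * From a universe to irreducible representations *)

Section IrreducibleComponents.
Variables (R : realType) (gT : finGroupType).
Implicit Types K H : {group gT}.
Local Notation G := [set: gT]%G.

Lemma mxdirect_sum_inj (F : fieldType) n (I : finType) (W : I -> 'M[F]_n)
    (x y : I -> 'rV[F]_n) :
    mxdirect (\sum_i W i)%MS ->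
    (forall i, (x i <= W i)%MS) -> (forall i, (y i <= W i)%MS) ->
  \sum_i x i = \sum_i y i -> x =1 y.
Proof.
move=> /mxdirect_sumsP dxW xW yW exy i; apply/eqP; rewrite -subr_eq0 -submx0.
have sub_xy j : (x j - y j <= W j)%MS by rewrite addmx_sub// -scaleN1r scalemx_sub.
rewrite -(dxW i)// sub_capmx sub_xy/=.
have /eqP : \sum_j (x j - y j) = 0 by rewrite sumrB exy subrr.
rewrite (bigD1 i)//= addr_eq0 => /eqP ->.
rewrite -scaleN1r scalemx_sub// summx_sub_sums// => j _; exact: sub_xy.
Qed.

(** Decompose the representation that [u] generates into irreducible submodules.
    The action preserves the submodules and their sum is direct, so that an element
    that fixes [u] fixes each of its components. *)
Lemma irreducible_components (U : orth_rep R gT) (u : U) :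
  exists (I : finType) (d : I -> nat)
         (V : forall i, mx_representation R G (d i)) (v : forall i, 'rV[R]_(d i)),
    (forall i, mx_irreducible (V i) /\
       exists2 psi : {linear 'rV[R]_(d i) -> U},
         injective psi & equivariant (V i) psi) /\
    forall h, rep_act h u = u <-> forall i, repr_act (V i) h (v i) = v i.
Proof.
have [d [rG [psi [c [inj_psi eqv psic]]]]] := cyclic_model u.
(* The decomposition is stated classically, hence for boolean goals only. *)
apply/asboolP; apply: (mx_reducible_semisimple (mxmodule1 rG)
  (mx_Maschke_pchar rG (pchar_group R gT))) => -[I W /= simW defW dxW].
have modW i : mxmodule rG (W i) by case: (simW i).
have /sub_sumsmxP[a cE] : (c <= \sum_i W i)%MS by rewrite defW submx1.
pose cW i := a i *m W i; have cW_sub i : (cW i <= W i)%MS by exact: submxMl.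
apply/asboolP.
exists I, (fun i => \rank (W i)), (fun i => submod_repr (modW i)),
  (fun i => in_submod (W i) (cW i)); split=> [i|h].
  split; first exact/submod_mx_irr.
  exists (psi \o val_submod).
    by apply: inj_comp => //; apply: val_submod_inj.
  by move=> g v; rewrite /= /repr_act val_submodJ ?finset.inE// -eqv.
rewrite -psic -eqv cE; split=> [/inj_psi|stab].
  rewrite /repr_act mulmx_suml => e i; rewrite /= -in_submodJ//.
  congr in_submod; apply: (mxdirect_sum_inj dxW _ cW_sub e).
  by move=> j; apply: (mxmodule_trans (modW j)); rewrite ?submxMl ?finset.inE.
congr (psi _); rewrite /repr_act mulmx_suml; apply: eq_bigr => i _.
by rewrite -[RHS](in_submodK (cW_sub i)) -[in RHS]stab /repr_act val_submodJ
   ?finset.inE// in_submodK.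
Qed.

(** In a trivial representation the isotropy group of every point is the whole
    group, which is not proper. *)
Lemma Orb_nontrivial d (rG : mx_representation R G d) K H :
  Orb rG K H -> nontrivial_repr rG.
Proof.
move=> OK; have [HG _ _] := OK; move: OK; rewrite HG => /OrbP[pK [v stabv]].
apply: contraL pK => /fintype.subsetP triv; rewrite finset.properT negbK.
apply/eqP/finset.setP => h; rewrite finset.inE; apply/stabv.
rewrite /repr_act; have /rkerP[_ ->] := triv h^-1%g (finset.in_setT _).
by rewrite mulmx1.
Qed.

(** Trivial members of a family of irreducible representations contribute nothing
    to the generating relation, so they can be dropped. *)
Lemma ordinal_family (T : {group gT} -> {group gT} -> Prop) (J : finType)
    (d : J -> nat) (V : forall j, mx_representation R G (d j)) :
    (forall j, mx_irreducible (V j)) ->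
    (forall K H, T K H <->
      generated_transfer_system (fun K' H' => exists j, Orb (V j) K' H') K H) ->
  exists (n : nat) (d : 'I_n -> nat)
         (V : forall i : 'I_n, mx_representation R G (d i)),
    (forall i, mx_irreducible (V i) /\ nontrivial_repr (V i)) /\
    forall K H, T K H <->
      generated_transfer_system (fun K' H' => exists i, Orb (V i) K' H') K H.
Proof.
move=> irrV TV; pose A := [pred j | nontrivial_repr (V j)].
exists #|A|, (fun i => d (enum_val i)), (fun i => V (enum_val i)).
split=> [i|K H]; first by split=> //; exact: (enum_valP i).
rewrite TV; split=> TKH T' tT' ET'; apply: TKH => // K' H'.
  move=> [j OK']; apply: ET'.
  have Aj : j \in A by apply: Orb_nontrivial OK'.
  exists (enum_rank_in Aj j).
  exact: (eq_ind_r (fun j => Orb (V j) K' H') OK' (enum_rankK_in Aj Aj)).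
by move=> [i OK']; apply: ET'; exists (enum_val i).
Qed.

(** There are finitely many pairs [(K, H)]. For each pair with [T K H], take the
    irreducible components of the representation generated by a point of [U] with
    isotropy group [K] in [H]. These components generate [T K H], and as they
    embed in [U] their own orbits are admissible for [U]. *)
Lemma universe_transfer_generated (T : {group gT} -> {group gT} -> Prop)
    (U : orth_rep R gT) :
    transfer_system T ->
    (forall K H, T K H <-> point_transfer (fun g (u : U) => rep_act g u) K H) ->
  exists (n : nat) (d : 'I_n -> nat)
         (V : forall i : 'I_n, mx_representation R G (d i)),
    (forall i, mx_irreducible (V i) /\ nontrivial_repr (V i)) /\
    forall K H, T K H <->
      generated_transfer_system (fun K' H' => exists i, Orb (V i) K' H') K H.
Proof.
move=> tT TU.
pose family := {I : finType & {d : I -> nat &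
  forall i, mx_representation R G (d i)}}.
have comp (p : {group gT} * {group gT}) : exists F : family,
    let V := tagged (tagged F) in
    (forall i, mx_irreducible (V i) /\
       exists2 psi : {linear 'rV[R]_(tag (tagged F) i) -> U},
         injective psi & equivariant (V i) psi) /\
    (T p.1 p.2 -> exists v : forall i, 'rV[R]_(tag (tagged F) i),
      {in p.2, forall h, h \in p.1 <->
         forall i, repr_act (V i) h (v i) = v i}).
  have [|nT] := pselect (T p.1 p.2).
    move=> /TU[sKH [u stabu]].
    have [I [d [V [v [irrV stabv]]]]] := irreducible_components u.
    exists (Tagged _ (Tagged _ V) : family); split=> // _; exists v => h Hh.
    by rewrite -stabv; split=> /(stabu h Hh).
  (* Pairs that are not related get the empty family. *)
  pose V (i : 'I_0) : mx_representation R G 0 :=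
    match i with Ordinal m lt_m0 => False_rect _ (notF lt_m0) end.
  by exists (Tagged _ (Tagged _ V) : family); split=> // -[].
have [F FP] := choice comp.
apply: (@ordinal_family T {p : {group gT} * {group gT} & tag (F p)} _
  (fun x => tagged (tagged (F (tag x))) (tagged x))).
  by move=> x; case: ((FP (tag x)).1 (tagged x)).
move=> K H; set E := fun K' H' => _.
have [|tE EE minE] := @generated_transfer_system_least gT E.
  by move=> K' H' [x [-> _ _]]; apply: finset.subsetT.
split=> [TKH|]; last first.
  apply: (minE _ tT) => K' H' [x OK']; have [HG _ _] := OK'.
  move: OK'; rewrite HG => /OrbP[_ [v stabv]]; apply/TU.
  split; first exact: finset.subsetT.
  have [_ [psi inj_psi eqv]] := (FP (tag x)).1 (tagged x).
  exists (psi v) => h _; rewrite -eqv -stabv; split=> [/inj_psi//|].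
  by move=> e; rewrite e.
have [v stabv] := (FP (K, H)).2 TKH.
apply: (transfer_of_stabilizers tE _ _ stabv); last by have /TU[] := TKH.
move=> j K' OK'; apply: EE.
by exists (Tagged (fun p => tag (F p)) (j : tag (F (K, H)))).
Qed.

End IrreducibleComponents.

(** * The inner product of coefficient sequences *)

Section PolynomialForm.
Variable R : realType.
Implicit Types p q : {poly R}.

Definition poly_dot p q : R := \sum_(k < size p) p`_k * q`_k.

Lemma poly_dot_widen N p q : (size p <= N)%N ->
  poly_dot p q = \sum_(k < N) p`_k * q`_k.
Proof.
move=> pN; rewrite /poly_dot (big_ord_widen N (fun k => p`_k * q`_k))//.
rewrite big_mkcond/=; apply: eq_bigr => k _; case: ltnP => // pk.
by rewrite nth_default// mul0r.
Qed.

Lemma poly_dotC p q : poly_dot p q = poly_dot q p.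
Proof.
rewrite (@poly_dot_widen (maxn (size p) (size q)) p) ?leq_maxl//.
rewrite (@poly_dot_widen (maxn (size p) (size q)) q) ?leq_maxr//.
by apply: eq_bigr => k _; rewrite mulrC.
Qed.

Lemma poly_dotPl c p p' q :
  poly_dot (c *: p + p') q = c * poly_dot p q + poly_dot p' q.
Proof.
rewrite ![poly_dot _ q]poly_dotC /poly_dot mulr_sumr -big_split/=.
by apply: eq_bigr => k _; rewrite coefD coefZ; ring.
Qed.

Lemma poly_dot_ge0 p : 0 <= poly_dot p p.
Proof. by apply: sumr_ge0 => k _; rewrite -expr2 sqr_ge0. Qed.

Lemma poly_dot_gt0 p : p != 0 -> 0 < poly_dot p p.
Proof.
move=> p0; have sp : ((size p).-1 < size p)%N.
  by rewrite ltn_predL lt0n size_poly_eq0.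
rewrite /poly_dot (bigD1 (Ordinal sp))//= ltr_pwDl//.
  by rewrite -expr2 exprn_even_gt0//= -lead_coefE lead_coef_eq0.
by apply: sumr_ge0 => k _; rewrite -expr2 sqr_ge0.
Qed.

Lemma poly_dot_shift m p q : poly_dot ('X^m * p) ('X^m * q) = poly_dot p q.
Proof.
rewrite (@poly_dot_widen (m + size p)).
  rewrite big_split_ord/= big1 ?add0r => [|k _].
    by apply: eq_bigr => k _; rewrite !coefXnM ltnNge leq_addr/= addKn.
  by rewrite !coefXnM ltn_ord mul0r.
by rewrite (leq_trans (size_polyMleq _ _))// size_polyXn addSn.
Qed.

(** Shifting by distinct multiples of [N] separates the supports of the
    coefficient sequences. *)
Lemma poly_dot_shift_orthogonal N p q k l :
    (size p <= N)%N -> (size q <= N)%N -> k != l ->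
  poly_dot ('X^(k * N) * p) ('X^(l * N) * q) = 0.
Proof.
move=> pN qN; wlog kl : p q pN qN k l / (k < l)%N.
  move=> H; rewrite neq_ltn => /orP[] kl; first by rewrite H// ltn_eqF.
  by rewrite poly_dotC H// ltn_eqF.
move=> _; apply: big1 => j _; rewrite !coefXnM.
case: (ltnP j (k * N)) => jk; first by rewrite mul0r.
case: (ltnP j (l * N)) => jl; first by rewrite mulr0.
rewrite (nth_default _ (_ : size p <= _)%N) ?mul0r//.
by apply: leq_trans pN _; nia.
Qed.

End PolynomialForm.

(** * From irreducible representations to a universe *)

Section PolynomialUniverse.
Variables (R : realType) (gT : finGroupType) (J : finType) (d : J -> nat).
Local Notation G := [set: gT]%G.
Variable V : forall j, mx_representation R G (d j).

(** The coordinates of the direct sum of the [V j] and, for [None], of a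
    one-dimensional trivial representation. *)
Definition coordinate := option {j : J & 'I_(d j)}.

(** The direct sum tensored with the space of real polynomials, that is a direct
    sum of countably many copies of it: the coefficients of [X^k] form the [k]-th
    copy. *)
Definition poly_vector := {ffun coordinate -> {poly R}}.
Implicit Types (p q : poly_vector) (g h : gT).

Definition coord j (r : 'I_(d j)) : coordinate :=
  Some (Tagged (fun j => 'I_(d j)) r).

Definition coef_row j k p : 'rV[R]_(d j) := \row_r (p (coord r))`_k.

Lemma coef_row_is_linear j k : linear (coef_row j k).
Proof. by move=> c p q; apply/rowP => r; rewrite !mxE !ffunE coefD coefZ. Qed.

HB.instance Definition _ j k := GRing.isLinear.Build R poly_vector 'rV[R]_(d j)
  *:%R (coef_row j k) (coef_row_is_linear j k).

Lemma poly_vector_eqP p q :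
  p None = q None -> (forall j k, coef_row j k p = coef_row j k q) -> p = q.
Proof.
move=> pq0 pq; apply/ffunP => -[[j r]|//]; apply/polyP => k.
by have /rowP/(_ r) := pq j k; rewrite !mxE.
Qed.

Definition poly_act g p : poly_vector := [ffun x =>
  if x is Some y then \sum_s V (tag y) g^-1%g s (tagged y) *: p (coord s)
  else p None].

Lemma poly_act_None g p : poly_act g p None = p None.
Proof. by rewrite ffunE. Qed.

Lemma coef_row_act j k g p :
  coef_row j k (poly_act g p) = repr_act (V j) g (coef_row j k p).
Proof.
apply/rowP => r; rewrite !mxE ffunE /= coef_sum; apply: eq_bigr => s _.
by rewrite coefZ mxE mulrC.
Qed.

Lemma poly_act_is_linear g : linear (poly_act g).
Proof.
move=> c p q; apply: poly_vector_eqP => [|j k]; first by rewrite !ffunE.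
by rewrite coef_row_act !linearP/= !coef_row_act.
Qed.

HB.instance Definition _ g := GRing.isLinear.Build R poly_vector poly_vector *:%R
  (poly_act g) (poly_act_is_linear g).

Lemma poly_act1 p : poly_act 1%g p = p.
Proof.
apply: poly_vector_eqP => [|j k]; first by rewrite ffunE.
by rewrite coef_row_act repr_act1.
Qed.

Lemma poly_actM g h p : poly_act (g * h)%g p = poly_act g (poly_act h p).
Proof.
apply: poly_vector_eqP => [|j k]; first by rewrite !ffunE.
by rewrite !coef_row_act repr_actM.
Qed.

Lemma poly_act_fixed g p :
  poly_act g p = p <-> forall j k, repr_act (V j) g (coef_row j k p) = coef_row j k p.
Proof.
split=> [e j k|fix_p]; first by rewrite -coef_row_act e.
by apply: poly_vector_eqP => [|j k]; rewrite ?poly_act_None ?coef_row_act.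
Qed.

(** Multiplication by [X^m] moves the copies of the direct sum along, which makes
    room for a second vector, or for further copies of a subrepresentation. *)
Definition shift m p : poly_vector := [ffun x => 'X^m * p x].

Lemma shift_is_linear m : linear (shift m).
Proof. by move=> c p q; apply/ffunP => x; rewrite !ffunE mulrDr scalerAr. Qed.

HB.instance Definition _ m := GRing.isLinear.Build R poly_vector poly_vector *:%R
  (shift m) (shift_is_linear m).

Lemma shift_act m g p : shift m (poly_act g p) = poly_act g (shift m p).
Proof.
apply/ffunP => -[[j r]|]; rewrite !ffunE//= mulr_sumr.
by apply: eq_bigr => s _; rewrite ffunE scalerAr.
Qed.

Definition size_bounded N p := forall x, (size (p x) <= N)%N.

Lemma size_bounded_exists p : exists N, size_bounded N p.
Proof. by exists (\max_x size (p x)) => x; apply: (leq_bigmax x). Qed.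

Lemma size_boundedD N p q :
  size_bounded N p -> size_bounded N q -> size_bounded N (p + q).
Proof.
move=> pN qN x; rewrite ffunE (leq_trans (size_polyD _ _))//.
by rewrite geq_max pN qN.
Qed.

Lemma size_boundedZ N c p : size_bounded N p -> size_bounded N (c *: p).
Proof. by move=> pN x; rewrite ffunE (leq_trans (size_scale_leq _ _)). Qed.

Lemma size_bounded_sum N (I : finType) (F : I -> poly_vector) :
  (forall i, size_bounded N (F i)) -> size_bounded N (\sum_i F i).
Proof.
move=> FN; apply: (big_ind (size_bounded N)) => // [x|p q].
  by rewrite ffunE size_poly0.
exact: size_boundedD.
Qed.

Lemma size_bounded_act N g p : size_bounded N p -> size_bounded N (poly_act g p).
Proof.
move=> pN [[j r]|]; rewrite ffunE//=.
apply: (leq_trans (size_sum _ _ _)); apply/bigmax_leqP => s _.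
by rewrite (leq_trans (size_scale_leq _ _)).
Qed.

Definition coord_dot p q : R := \sum_x poly_dot (p x) (q x).

(** The unitarian trick: averaging over the group makes any inner product
    invariant. *)
Definition invariant_dot p q : R :=
  \sum_(g : gT) coord_dot (poly_act g p) (poly_act g q).

Lemma coord_dotPl q c p p' :
  coord_dot (c *: p + p') q = c * coord_dot p q + coord_dot p' q.
Proof.
rewrite /coord_dot mulr_sumr -big_split/=; apply: eq_bigr => x _.
by rewrite !ffunE poly_dotPl.
Qed.

Lemma invariant_dotPl q c p p' :
  invariant_dot (c *: p + p') q = c * invariant_dot p q + invariant_dot p' q.
Proof.
rewrite /invariant_dot mulr_sumr -big_split/=; apply: eq_bigr => g _.
by rewrite linearP coord_dotPl.
Qed.

Lemma invariant_dotC p q : invariant_dot p q = invariant_dot q p.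
Proof. by apply: eq_bigr => g _; apply: eq_bigr => x _; rewrite poly_dotC. Qed.

Lemma coord_dot_ge0 p : 0 <= coord_dot p p.
Proof. by apply: sumr_ge0 => x _; apply: poly_dot_ge0. Qed.

Lemma invariant_dot_gt0 p : p != 0 -> 0 < invariant_dot p p.
Proof.
move=> p0; have [x px0] : exists x, p x != 0.
  apply: contrapT => np; move/eqP: p0; apply; apply/ffunP => x; rewrite ffunE.
  by apply: contrapT => /eqP px; apply: np; exists x.
rewrite /invariant_dot (bigD1 1%g)//= poly_act1 ltr_pwDl//; last first.
  by apply: sumr_ge0 => g _; apply: coord_dot_ge0.
rewrite /coord_dot (bigD1 x)//= ltr_pwDl ?poly_dot_gt0//.
by apply: sumr_ge0 => y _; apply: poly_dot_ge0.
Qed.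

Lemma invariant_dot_act h p q :
  invariant_dot (poly_act h p) (poly_act h q) = invariant_dot p q.
Proof.
rewrite /invariant_dot [RHS](reindex_inj (mulIg h))/=.
by apply: eq_bigr => g _; rewrite !poly_actM.
Qed.

Lemma invariant_dot_shift m p q :
  invariant_dot (shift m p) (shift m q) = invariant_dot p q.
Proof.
apply: eq_bigr => g _; apply: eq_bigr => x _.
by rewrite -!shift_act ![shift _ _ _]ffunE poly_dot_shift.
Qed.

Lemma invariant_dot_shift_orthogonal N p q k l :
    size_bounded N p -> size_bounded N q -> k != l ->
  invariant_dot (shift (k * N) p) (shift (l * N) q) = 0.
Proof.
move=> pN qN kl; apply: big1 => g _; apply: big1 => x _.
rewrite -!shift_act ![shift _ _ _]ffunE poly_dot_shift_orthogonal//.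
all: exact: size_bounded_act.
Qed.

Lemma shift_pair_inj N p p' q q' : size_bounded N p -> size_bounded N p' ->
  p + shift N q = p' + shift N q' -> p = p' /\ q = q'.
Proof.
move=> pN p'N /ffunP epq.
have epp : p = p'.
  apply/ffunP => x; apply/polyP => k; have /polyP/(_ k) := epq x.
  rewrite !ffunE !coefD !coefXnM; case: ltnP => [_|Nk _]; first by rewrite !addr0.
  by rewrite !nth_default// (leq_trans _ Nk).
split=> //; apply/ffunP => x; apply/polyP => k.
have /polyP/(_ (k + N)%N) := epq x; rewrite epp !ffunE !coefD !coefXnM.
by rewrite ltnNge leq_addl/= addnK => /addrI.
Qed.

(** Place [q] in the copies of the direct sum where [p] has no component; then
    the isotropy group of the sum is the intersection of those of [p] and [q]. *)
Lemma poly_act_pairing p q : exists r, forall h,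
  poly_act h r = r <-> poly_act h p = p /\ poly_act h q = q.
Proof.
have [N pN] := size_bounded_exists p; exists (p + shift N q) => h.
rewrite linearD/= -shift_act; split=> [|[-> ->]//].
by move/shift_pair_inj; apply=> //; apply: size_bounded_act.
Qed.

Definition trivial_vector : poly_vector := [ffun x => (x == None)%:R].

Lemma trivial_vector_neq0 : trivial_vector != 0.
Proof.
by apply/eqP => /ffunP/(_ None); rewrite !ffunE eqxx => /eqP; rewrite oner_eq0.
Qed.

Lemma poly_act_trivial_vector g : poly_act g trivial_vector = trivial_vector.
Proof.
apply/poly_act_fixed => j k.
suff -> : coef_row j k trivial_vector = 0 by rewrite linear0.
by apply/rowP => r; rewrite !mxE ffunE coef0.
Qed.

Definition constant_vector j (v : 'rV[R]_(d j)) : poly_vector :=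
  [ffun x => (\sum_r (x == coord r)%:R * v 0 r)%:P].

Lemma coef_row_constant j (v : 'rV[R]_(d j)) : coef_row j 0 (constant_vector v) = v.
Proof.
apply/rowP => r; rewrite !mxE ffunE coefC/= (bigD1 r)//= eqxx mul1r.
rewrite big1 ?addr0// => s sr; case: eqP => [[]|]; last by rewrite mul0r.
by move=> /eqP; rewrite eq_Tagged/= eq_sym (negPf sr).
Qed.

Lemma poly_act_constant j (v : 'rV[R]_(d j)) g :
  poly_act g (constant_vector v) = constant_vector v <-> repr_act (V j) g v = v.
Proof.
rewrite poly_act_fixed; split=> [/(_ j 0%N)|gv i k].
  by rewrite coef_row_constant.
have [ij|ij] := eqVneq i j; last first.
  suff -> : coef_row i k (constant_vector v) = 0 by rewrite linear0.
  apply/rowP => r; rewrite !mxE ffunE coefC big1 ?if_same// => s _.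
  case: eqP => [/Some_inj/(congr1 tag)/= e|]; last by rewrite mul0r.
  by rewrite e eqxx in ij.
case: k => [|k]; first by subst i; rewrite coef_row_constant.
suff -> : coef_row i k.+1 (constant_vector v) = 0 by rewrite linear0.
by apply/rowP => r; rewrite !mxE ffunE coefC.
Qed.

Let N := #|{: coordinate}|.

Let N_gt0 : (0 < N)%N. Proof. by apply/card_gt0P; exists None. Qed.

Let var m : coordinate := nth None (enum {: coordinate}) (m %% N).

Let pos x k : nat := (k * N + index x (enum {: coordinate}))%N.

Let index_lt x : (index x (enum {: coordinate}) < N)%N.
Proof. by rewrite /N cardE index_mem mem_enum. Qed.

Let var_pos m x k : (var m == x) && ((m %/ N)%N == k) = (m == pos x k).
Proof.
apply/andP/eqP => [[/eqP <- /eqP <-]|->].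
  rewrite /pos /var index_uniq ?enum_uniq -?cardE ?ltn_pmod//.
  exact: divn_eq.
rewrite /var /pos divnMDl// divn_small// addn0 modnMDl modn_small//.
by rewrite nth_index ?mem_enum.
Qed.

(** The basis indexed by pairs of a coordinate and a degree; [m] encodes the
    coordinate of rank [m %% N] and the degree [m %/ N]. *)
Definition monomial m : poly_vector :=
  [ffun x => if x == var m then 'X^(m %/ N) else 0].

Let monomial_sumE D (c : 'I_D -> R) x k :
  ((\sum_i c i *: monomial i) x)`_k = \sum_i c i * (i == pos x k :> nat)%:R.
Proof.
rewrite sum_ffunE coef_sum; apply: eq_bigr => i _.
rewrite !ffunE coefZ -var_pos eq_sym; case: eqP => _ /=; last by rewrite coef0.
by rewrite coefXn eq_sym.
Qed.

Lemma monomial_span p : exists D (c : 'I_D -> R), p = \sum_i c i *: monomial i.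
Proof.
have [K pK] := size_bounded_exists p.
exists (K * N)%N, (fun i => (p (var i))`_(i %/ N)).
apply/ffunP => x; apply/polyP => k; rewrite monomial_sumE.
have [lt_pos|ge_pos] := ltnP (pos x k) (K * N)%N.
  rewrite (bigD1 (Ordinal lt_pos))//= eqxx mulr1 big1 ?addr0 => [|i].
    by have /andP[/eqP -> /eqP ->] : _ := etrans (var_pos _ x k) (eqxx (pos x k)).
  by rewrite -val_eqE/= => /negPf ->; rewrite mulr0.
rewrite big1 => [|i _]; last first.
  by rewrite ltn_eqF ?mulr0// (leq_trans (ltn_ord i)).
rewrite nth_default// (leq_trans (pK x))//.
have := index_lt x; move: ge_pos; rewrite /pos; nia.
Qed.

Lemma monomial_free D (c : 'I_D -> R) :
  \sum_i c i *: monomial i = 0 -> forall i, c i = 0.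
Proof.
move=> c0 i; have := monomial_sumE c (var i) (i %/ N).
rewrite c0 ffunE coef0 (bigD1 i)//= -var_pos !eqxx mulr1 big1 ?addr0 => [->//|k].
move=> ki; suff -> : (k == pos (var i) (i %/ N) :> nat) = false.
  by rewrite mulr0.
have /eqP <- : i == pos (var i) (i %/ N) :> nat by rewrite -var_pos !eqxx.
exact: negPf ki.
Qed.

(** A subrepresentation of finite dimension has polynomials of bounded size [B],
    so that its shifts by multiples of [B] are orthogonal copies of it. *)
Lemma universe_exists : exists U : orth_rep R gT, G_universe U /\
  forall K H, steiner_transfer U K H <-> point_transfer poly_act K H.
Proof.
have [U [e [e' [eK e'K dot_e eqv_e]]]] := orth_rep_of invariant_dotPl invariant_dotC
  invariant_dot_gt0 (act := fun g => poly_act g) poly_act1 poly_actM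
  invariant_dot_act.
have {}eqv_e g p : e (poly_act g p) = rep_act g (e p) by exact: eqv_e.
exists U; split; last first.
  move=> K H; rewrite steiner_transferP; split=> -[sKH [u stabu]]; split=> //.
    exists (e' u) => h Hh; rewrite -stabu//; split=> [e'u|eu].
      by have := eqv_e h (e' u); rewrite e'u e'K.
    by rewrite -(eK (poly_act h _)) eqv_e e'K eu.
  exists (e u) => h Hh; rewrite -stabu// -eqv_e; split=> [|->//].
  exact: (can_inj eK).
split.
- exists (e \o monomial); split=> [u|D c].
    have [D [c e'u]] := monomial_span (e' u); exists D, c.
    by rewrite -(e'K u) e'u linear_sum; apply: eq_bigr => i _; rewrite linearZ.
  move=> c0; apply: monomial_free; apply: (can_inj eK); rewrite linear0 -c0.
  by rewrite linear_sum; apply: eq_bigr => i _; rewrite linearZ.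
- move=> W i [D [b spanb]] [dot_i eqv_i].
  have [B bB] : exists B, forall w, size_bounded B (e' (i w)).
    have /choice[B0 B0P] := fun k => size_bounded_exists (e' (i (b k))).
    exists (\max_k B0 k) => w; have [c ->] := spanb w.
    rewrite !linear_sum; apply: size_bounded_sum => k.
    rewrite !linearZ/=; apply: size_boundedZ => x.
    by apply: leq_trans (B0P k x) _; apply: leq_bigmax.
  exists (fun k => e \o shift (k * B) \o e' \o i); split=> [k|k l kl v w] /=.
    split=> [v w|g v] /=; first by rewrite dot_e invariant_dot_shift -dot_e !e'K.
    rewrite eqv_i -eqv_e -shift_act; congr (e (shift _ _)).
    by apply: (can_inj eK); rewrite eqv_e !e'K.
  by rewrite dot_e (@invariant_dot_shift_orthogonal B).
- exists (e trivial_vector); split=> [|g].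
    apply/eqP => e0; move/eqP: trivial_vector_neq0; apply; apply: (can_inj eK).
    by rewrite linear0.
  by rewrite -eqv_e poly_act_trivial_vector.
Qed.

(** The right side is a transfer system that contains the generators, because a
    vector of [V j] can be placed among the constant polynomials. Conversely an
    isotropy group in the universe is an intersection of isotropy groups of
    points of the [V j], finitely many because the polynomials have finitely many
    coefficients. *)
Lemma generated_transfer_universe K H :
  generated_transfer_system (fun K' H' => exists j, Orb (V j) K' H') K H <->
  point_transfer poly_act K H.
Proof.
set E := fun K' H' => _.
have [|tE EE minE] := @generated_transfer_system_least gT E.
  by move=> K' H' [x [-> _ _]]; apply: finset.subsetT.
split=> [|[sKH [p stabp]]].
  apply: minE => [|K' H' [j OK']].
    apply: point_transfer_system poly_act1 poly_actM _ poly_act_pairing.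
    by exists trivial_vector; apply: poly_act_trivial_vector.
  have [HG _ _] := OK'; move: OK'; rewrite HG => /OrbP[_ [v stabv]].
  split; first exact: finset.subsetT.
  by exists (constant_vector v) => h _; rewrite poly_act_constant.
have [B pB] := size_bounded_exists p.
(* Beyond degree [B] all components vanish and are fixed. *)
apply: (@transfer_of_stabilizers _ _ _ (J * 'I_B)%type _ (fun jk => V jk.1)
  (fun jk => coef_row jk.1 jk.2 p)) => //.
  by move=> [j k] K' /= OK'; apply: EE; exists j.
move=> h Hh; rewrite -stabp// poly_act_fixed; split=> [fixp [j k]//|fixp j k].
have [kB|Bk] := ltnP k B; first exact: fixp (j, Ordinal kB).
suff -> : coef_row j k p = 0 by rewrite linear0.
by apply/rowP => r; rewrite !mxE nth_default// (leq_trans (pB _)).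
Qed.

End PolynomialUniverse.

Theorem theorem4p6 (R : realType) (gT : finGroupType)
    (T : {group gT} -> {group gT} -> Prop) :
  transfer_system T ->
  (exists U : orth_rep R gT, G_universe U /\
     forall K H, T K H <-> steiner_transfer U K H)
  <->
  (exists (n : nat) (d : 'I_n -> nat)
          (V : forall i : 'I_n, mx_representation R [set: gT]%G (d i)),
     (forall i, mx_irreducible (V i) /\ nontrivial_repr (V i)) /\
     forall K H, T K H <->
       generated_transfer_system (fun K' H' => exists i, Orb (V i) K' H') K H).
Proof.
move=> tT; split=> [[U [_ TU]]|[n [d [V [_ TV]]]]].
  apply: (universe_transfer_generated tT) => K H.
  by rewrite TU; apply: steiner_transferP.
have [U [univU stU]] := universe_exists V; exists U; split=> // K H.
by rewrite TV stU; apply: generated_transfer_universe.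
Qed.
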